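(* Let $(X_n)_{n\in\mathbb{N}}$ be a Markov chain on a finite state space $S$ with transition probability matrix $P$ and associated graph $G=(S,E)$. A point $i\in S$ is a recurrent (and positive recurrent) point of the Markov chain if and only if $i\in\bigcup C$, where the union is over all maximal communicating classes $C$ of the graph $G$. That is, for $i\in S$: $i$ is recurrent $\iff$ $i$ is positive recurrent $\iff$ $i$ belongs to a maximal communicating class of $G$.
   Context: Markov chains are time-homogeneous; $p(i,j)$ are the entries of $P$. The associated graph $G=(S,E)$ has $(i,j)\in E$ iff $p(i,j)>0$. Write $i\sim j$ if there are directed paths of length $\ge 1$ in $G$ from $i$ to $j$ and from $j$ to $i$; let $V_c=\{i\in S:i\sim j \text{ for some } j\in S\}$; the communicating classes of $G$ are the sets $[i]=\{j\in S: j\sim i\}$, $i\in V_c$. They are partially ordered by $C_\mu\preceq C_\nu$ iff there is a path in $G$ from some vertex of $C_\mu$ to some vertex of $C_\nu$; ''maximal'' means maximal with respect to $\preceq$. With $\tau_i=\inf\{n\ge1: X_n=i\}$, a state $i$ is recurrent if $\mathbb{P}\{\tau_i<\infty\mid X_0=i\}=1$, and positive recurrent if moreover $\mathbb{E}(\tau_i\mid X_0=i)<\infty$. *)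

(* Defs.v *)
From HB Require Import structures.
From mathcomp Require Import all_boot all_order all_algebra.
From mathcomp Require Import all_classical all_reals all_analysis.
Set Implicit Arguments.
Unset Strict Implicit.
Unset Printing Implicit Defensive.
Import Order.TTheory GRing.Theory Num.Theory.
Local Open Scope classical_set_scope.
Local Open Scope ring_scope.

Definition stochastic (R : realType) (S : finType) (P : S -> S -> R) : Prop :=
  (forall i j, 0 <= P i j) /\ (forall i, \sum_(j in S) P i j = 1).

(* Elementary conditioning on an event; only used when 0 < Pr B. *)
Definition cond_prob (R : realType) (d : measure_display) (T : measurableType d)
    (Pr : probability T R) (A B : set T) : \bar R :=
  (Pr (A `&` B) / Pr B)%E.

Definition cond_expectation (R : realType) (d : measure_display)
    (T : measurableType d) (Pr : probability T R) (Y : T -> \bar R) (B : set T) :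
    \bar R :=
  ((\int[Pr]_(w in B) Y w) / Pr B)%E.

(* The initial law is arbitrary; the first clause says that each X n is a
   random element of S with its discrete sigma-algebra. *)
Definition markov_chain (R : realType) (S : finType) (P : S -> S -> R)
    (d : measure_display) (T : measurableType d) (Pr : probability T R)
    (X : nat -> T -> S) : Prop :=
  (forall n i, measurable [set w | X n w = i]) /\
  (forall (n : nat) (x : nat -> S) (j : S),
     let past := [set w | forall k : nat, (k <= n)%N -> X k w = x k] in
     (0 < Pr past)%E ->
     cond_prob Pr [set w | X n.+1 w = j] past = (P (x n) j)%:E).

(* The infimum is +oo when i is never visited at a time n >= 1. *)
Definition return_time (R : realType) (S : finType) (T : Type)
    (X : nat -> T -> S) (i : S) (w : T) : \bar R :=
  ereal_inf [set (n%:R)%:E | n in [set n : nat | (1 <= n)%N /\ X n w = i]].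

Definition returns_as (R : realType) (S : finType) (d : measure_display)
    (T : measurableType d) (Pr : probability T R) (X : nat -> T -> S) (i : S) :
    Prop :=
  cond_prob Pr [set w | (return_time R X i w < +oo)%E] [set w | X 0%N w = i]
  = 1%E.

Definition mean_return_finite (R : realType) (S : finType) (d : measure_display)
    (T : measurableType d) (Pr : probability T R) (X : nat -> T -> S) (i : S) :
    Prop :=
  (cond_expectation Pr (return_time R X i) [set w | X 0%N w = i] < +oo)%E.

(* "Phi holds given X_0 = i".  If the initial law of the chain charges i, this
   is a statement about the chain itself.  Otherwise conditioning on X_0 = i is
   undefined, and the usual convention applies: the chain is restarted, i.e.
   replaced by a chain with the same matrix P whose initial law charges i. *)
Definition given_start (R : realType) (S : finType) (P : S -> S -> R)
    (Phi : forall (d : measure_display) (T : measurableType d),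
       probability T R -> (nat -> T -> S) -> S -> Prop)
    (d : measure_display) (T : measurableType d) (Pr : probability T R)
    (X : nat -> T -> S) (i : S) : Prop :=
  ((0 < Pr [set w | X 0%N w = i])%E -> Phi d T Pr X i) /\
  (Pr [set w | X 0%N w = i] = 0%E ->
   forall (d' : measure_display) (T' : measurableType d')
     (Pr' : probability T' R) (X' : nat -> T' -> S),
     markov_chain P Pr' X' -> (0 < Pr' [set w | X' 0%N w = i])%E ->
     Phi d' T' Pr' X' i).

Definition recurrent (R : realType) (S : finType) (P : S -> S -> R)
    (d : measure_display) (T : measurableType d) (Pr : probability T R)
    (X : nat -> T -> S) (i : S) : Prop :=
  given_start P (@returns_as R S) Pr X i.

Definition positive_recurrent (R : realType) (S : finType) (P : S -> S -> R)
    (d : measure_display) (T : measurableType d) (Pr : probability T R)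
    (X : nat -> T -> S) (i : S) : Prop :=
  recurrent P Pr X i /\ given_start P (@mean_return_finite R S) Pr X i.

Definition edge (R : realType) (S : finType) (P : S -> S -> R) : rel S :=
  [rel i j | 0 < P i j].

Definition pos_path (S : finType) (e : rel S) (i j : S) : Prop :=
  exists p : seq S, [/\ (1 <= size p)%N, path e i p & last i p = j].

Definition communicate (S : finType) (e : rel S) (i j : S) : Prop :=
  pos_path e i j /\ pos_path e j i.

(* States communicating with no state, themselves included, are in no class. *)
Definition communicating_class (S : finType) (e : rel S) (C : set S) : Prop :=
  exists i : S, (exists j : S, communicate e i j) /\
                C = [set j | communicate e j i].

(* [connect] also allows paths of length 0, which makes no difference here. *)
Definition class_le (S : finType) (e : rel S) (C D : set S) : Prop :=
  exists x y : S, [/\ C x, D y & connect e x y].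

Definition maximal_class (S : finType) (e : rel S) (C : set S) : Prop :=
  communicating_class e C /\
  forall D : set S, communicating_class e D -> class_le e C D -> D = C.

(* Main.v *)
Require Import Defs.
From HB Require Import structures.
From mathcomp Require Import all_boot all_order all_algebra.
From mathcomp Require Import all_classical all_reals all_analysis.
From mathcomp Require Import measurable_realfun.
Set Implicit Arguments.
Unset Strict Implicit.
Unset Printing Implicit Defensive.
Import Order.TTheory GRing.Theory Num.Theory.
Local Open Scope classical_set_scope.
Local Open Scope ring_scope.

(** A state lies in a maximal class iff every state reachable from it leads back
    to it.  Conditioning on the first step, the probability of starting at [i]
    and avoiding [i] at the times [1, ..., m] is [Pr (X_0 = i)] times a number
    [avoid m i] that depends on [P] only.  If all reachable states lead back to
    [i], then [avoid (m + N) i <= r * avoid m i] for some [N] and [r < 1], so the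
    expected return time, [\sum_m avoid m i], is finite; otherwise some path
    that does not revisit [i] ends in a state that cannot reach [i], and
    [avoid m i] stays above the probability of that path.

    When the initial law does not charge [i], recurrence quantifies over the
    chains started at [i], so that at least one of them must be constructed. *)

(** * Communicating classes *)

Section Graph.
Variables (S : finType) (e : rel S).

Lemma pos_pathP (i j : S) :
  pos_path e i j <-> exists2 k, e i k & connect e k j.
Proof.
split=> [[[|k p] [//= _ /andP[eik pk] lkj]]|[k eik /connectP[p pk ->]]].
  by exists k => //; apply/connectP; exists p.
by exists (k :: p); split=> //=; rewrite eik.
Qed.

Lemma pos_path_connect (i j : S) : pos_path e i j -> connect e i j.
Proof. by case/pos_pathP=> k /connect1; apply: connect_trans. Qed.

(** The only obstacle is the empty path, where [i = j] and the cycle through [j] serves instead. *)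
Lemma connect_pos_path (i j : S) :
  connect e i j -> pos_path e j j -> pos_path e i j.
Proof.
case/connectP=> -[|k p] /=; first by move=> _ ->.
case/andP=> eik pk -> _; apply/pos_pathP; exists k => //.
by apply/connectP; exists p.
Qed.

Lemma communicateP (i j : S) : pos_path e i i ->
  communicate e j i <-> connect e i j /\ connect e j i.
Proof.
move=> ii; split=> [[/pos_path_connect ? /pos_path_connect ?] //|[cij cji]].
split; first exact: connect_pos_path.
have /pos_pathP[k eik cki] := ii.
by apply/pos_pathP; exists k => //; apply: connect_trans cki cij.
Qed.

(* A state reachable from [j] that reaches as few states as possible is in a
   closed class. *)
Lemma reach_closed (j : S) :
  exists2 k, connect e j k & forall l, connect e k l -> connect e l k.
Proof.
case: (arg_minnP (fun k => #|connect e k|) (connect0 e j)) => k cjk min_k.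
exists k => // l ckl; have cjl := connect_trans cjk ckl.
have sub : connect e l \subset connect e k.
  by apply/fintype.subsetP=> m; apply: connect_trans.
have : #|connect e l| == #|connect e k|.
  by rewrite eqn_leq subset_leq_card //= min_k.
by rewrite (subset_leqif_card sub) => /fintype.subsetP; apply; exact: connect0.
Qed.

(** Left to right, [j] reaches a closed class, which lies above that of [i] and so equals it by
    maximality. Conversely, [out] puts [i] on a cycle, hence in a class, and every class above that
    one leads back to [i]. *)
Lemma maximal_classP (i : S) (out : forall j, exists k, e j k) :
  (\bigcup_(C in [set C | maximal_class e C]) C) i <->
  forall j, connect e i j -> connect e j i.
Proof.
have loop k : (forall l, connect e k l -> connect e l k) -> pos_path e k k.
  move=> closed_k; have [l ekl] := out k.
  by apply/pos_pathP; exists l => //; exact/closed_k/connect1.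
split=> [[C [[i0 [[j0 [i0j0 j0i0]] ->]]] maxC Ci] j cij|closed_i].
  have ii : pos_path e i i.
    have [ii0 i0i] := Ci.
    have /pos_pathP[l eil cl] := ii0; apply/pos_pathP; exists l => //.
    exact: connect_trans cl (pos_path_connect i0i).
  have [k cjk closed_k] := reach_closed j.
  have kk := loop _ closed_k.
  have DC : [set l | communicate e l k] = [set l | communicate e l i0].
    apply: maxC; first by exists k; split=> //; exists k.
    exists i, k; split=> //=.
    exact: connect_trans cij cjk.
  have [/pos_path_connect cik /pos_path_connect cki] : communicate e i k.
    by have : [set l | communicate e l i0] i by []; rewrite -DC.
  exact: connect_trans cjk cki.
have ii := loop _ closed_i.
exists [set l | communicate e l i] => //=.
split; first by exists i; split=> //; exists i.
move=> D [k [[k' [kk' k'k]] ->]] [x [y [xi yk cxy]]].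
have kk : pos_path e k k.
  have /pos_pathP[l ekl cl] := kk'; apply/pos_pathP; exists l => //.
  exact: connect_trans cl (pos_path_connect k'k).
have cik : connect e i k.
  move: xi yk => [_ /pos_path_connect cix] [/pos_path_connect cyk _].
  exact/(connect_trans cix)/(connect_trans cxy).
have cki := closed_i _ cik.
apply/seteqP; split=> l; rewrite /= !communicateP // => -[c1 c2].
  by split; [apply: connect_trans cik c1 | apply: connect_trans c2 cki].
by split; [apply: connect_trans cki c1 | apply: connect_trans c2 cik].
Qed.

End Graph.

(** * Avoiding a state *)

Section Taboo.
Variables (R : realType) (S : finType) (P : S -> S -> R) (i : S).
Hypothesis hP : stochastic P.

Let P_ge0 j k : 0 <= P j k. Proof. by case: hP. Qed.
Let P_sum1 j : \sum_k P j k = 1. Proof. by case: hP. Qed.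

(* The probability, starting from [j], of not being at [i] at any of the times
   [1, ..., m]. *)
Fixpoint avoid (m : nat) (j : S) : R :=
  if m is m'.+1 then \sum_(k | k != i) P j k * avoid m' k else 1.

Lemma avoid_ge0 m j : 0 <= avoid m j.
Proof.
by elim: m j => //= m IH j; apply: sumr_ge0 => k _; apply: mulr_ge0.
Qed.

Lemma stochastic_out j : exists k, edge P j k.
Proof.
apply/existsP; apply: contraT => /existsPn no.
have : \sum_k P j k = 0.
  apply: big1 => k _; apply/eqP; rewrite eq_le P_ge0 andbT leNgt; exact: no.
by rewrite P_sum1 => /eqP; rewrite oner_eq0.
Qed.

Lemma sum_avoid_le (f : S -> R) j :
  (forall k, 0 <= f k <= 1) -> \sum_(k | k != i) P j k * f k <= 1.
Proof.
move=> f01; rewrite -(P_sum1 j) big_mkcond /=; apply: ler_sum => k _.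
have /andP[f0 f1] := f01 k.
by case: ifP => _ //; rewrite ler_piMr.
Qed.

Lemma avoid_le1 m j : avoid m j <= 1.
Proof.
by case: m => //= m; elim: m j => [|m IH] j; apply: sum_avoid_le => k;
   rewrite avoid_ge0 /= ?lexx.
Qed.

Lemma avoidS_le m j : avoid m.+1 j <= avoid m j.
Proof.
elim: m j => [|m IH] j; first exact: avoid_le1.
by apply: ler_sum => k _; apply: ler_wpM2l => //; exact: IH.
Qed.

Lemma avoid_noninc m n j : (m <= n)%N -> avoid n j <= avoid m j.
Proof.
move=> /subnK <-; elim: (n - m)%N => // k IH.
by rewrite addSn; apply: le_trans (avoidS_le _ _) IH.
Qed.

(** * Geometric decay of [avoid] in a closed class *)

Section ClosedClass.
Hypothesis closed_i : forall j, connect (edge P) i j -> connect (edge P) j i.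

(** Induction along a path from [j] to [i] of positive length: strict inequality at the end of its
    first edge passes to [j], because that edge has positive weight. *)
Lemma avoid_lt1 j : connect (edge P) i j -> exists m, avoid m j < 1.
Proof.
move=> cij.
have : pos_path (edge P) j i.
  have [k ejk] := stochastic_out j; apply/pos_pathP; exists k => //.
  exact/closed_i/(connect_trans cij)/connect1.
case=> -[|k p] [//= _ /andP[ejk pk] lp]; move: {cij} j k ejk pk lp.
elim: p => [|l p IH] j k ejk /=.
  (* The edge leads straight to [i]: the sum for [avoid] lacks the positive term [P j i]. *)
  move=> _ ki; subst k; exists 1%N => /=; rewrite -[ltRHS](P_sum1 j) big_mkcond /=.
  rewrite [ltRHS](bigD1 i) // [ltLHS](bigD1 i) //= eqxx ltr_leD //.
  by apply: ler_sum => l _; case: ifP => // _; rewrite mulr1.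
case/andP=> ekl pl lp; have [m lt1] := IH _ _ ekl pl lp.
exists m.+1 => /=; rewrite -[ltRHS](P_sum1 j) big_mkcond /=.
rewrite [ltRHS](bigD1 k) // [ltLHS](bigD1 k) //= ltr_leD //.
  by case: ifP => // _; rewrite gtr_pMr.
apply: ler_sum => k' _; case: ifP => // _.
by rewrite ler_piMr // avoid_le1.
Qed.

(* The first [N] steps reach [i] with probability at least [1 - r] from any
   state of the class, and the Markov property iterates this. *)
Lemma avoid_contract : exists (N : nat) (r : R),
  [/\ 0 <= r, r < 1 & forall m, avoid (m + N) i <= r * avoid m i].
Proof.
pose Q (j : S) n := connect (edge P) i j -> avoid n j < 1.
have /fin_all_exists[n Qn] j : exists n, Q j n.
  case: (boolP (connect (edge P) i j)) => [/avoid_lt1[m ?]|no]; first by exists m.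
  by exists 0%N => cij; rewrite cij in no.
pose N := (\max_j n j)%N.
have lt1 j : connect (edge P) i j -> avoid N j < 1.
  by move=> /Qn; apply: le_lt_trans; apply: avoid_noninc; exact: leq_bigmax.
(* The default 0 of the maximum yields both [0 <= r] and, with [lt1], [r < 1]. *)
pose r := \big[Num.max/0]_(j | connect (edge P) i j) avoid N j.
have r1 : r < 1 by apply/bigmax_ltP; split=> // j; exact: lt1.
exists N, r; split=> //; first exact: bigmax_ge_id.
suff H m j : connect (edge P) i j -> avoid (m + N) j <= r * avoid m j.
  by move=> m; exact/H/connect0.
elim: m j => [|m IH] j cij.
  by rewrite mulr1; apply: (le_bigmax_cond _ (fun j => avoid N j)).
rewrite /= mulr_sumr; apply: ler_sum => k _.
(* Only successors of positive probability are known to stay reachable from [i]; the others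
   contribute 0. *)
have [Pjk|] := ltP 0 (P j k).
  rewrite mulrCA ler_wpM2l // IH //; apply: connect_trans cij _.
  exact: connect1.
move=> Pjk; have -> : P j k = 0 by apply/eqP; rewrite eq_le Pjk P_ge0.
by rewrite !mul0r mulr0.
Qed.

(** Let [A M] be the partial sum. Splitting off the first [N] terms gives
    [A M <= A (M + N) <= N + r * A M]; solve for [A M]. *)
Lemma avoid_summable : exists K : R, forall M, \sum_(m < M) avoid m i <= K.
Proof.
have [N [r [r0 r1 contract]]] := avoid_contract.
exists (N%:R / (1 - r)) => M.
rewrite ler_pdivlMr ?subr_gt0 // mulrBr mulr1 lerBlDr.
apply: (@le_trans _ _ (\sum_(m < M + N) avoid m i)).
  by rewrite big_split_ord /= lerDl sumr_ge0 // => k _; apply: avoid_ge0.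
rewrite addnC big_split_ord /= lerD //.
  have -> : N%:R = \sum_(k < N) 1 :> R by rewrite sumr_const card_ord.
  by apply: ler_sum => k _; apply: avoid_le1.
rewrite mulr_suml; apply: ler_sum => k _.
by rewrite addnC mulrC contract.
Qed.

(** By monotonicity [m * avoid m i] is at most the sum of the first [m] terms, hence at most [K];
    any [m > K / eps] will do. *)
Lemma avoid_small (eps : R) : 0 < eps -> exists m, avoid m i < eps.
Proof.
move=> eps0; have [K hK] := avoid_summable.
have K0 : 0 <= K by have := hK 0%N; rewrite big_ord0.
have [m] : exists m : nat, K / eps < m%:R.
  exists (Num.bound (K / eps)); apply: archi_boundP.
  by rewrite divr_ge0 // ltW.
rewrite ltr_pdivrMr // => Km; exists m.
have : m%:R * avoid m i <= K.
  apply: le_trans (hK m); rewrite mulr_natl -[m in _ *+ m]card_ord -sumr_const.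
  by apply: ler_sum => k _; apply: avoid_noninc; apply: ltnW.
move=> /le_lt_trans /(_ Km); rewrite ltr_pM2l // ltr0n lt0n.
by apply: contraTneq Km => ->; rewrite mul0r -leNgt.
Qed.

End ClosedClass.

Lemma avoid_unreachable m j :
  ~~ connect (edge P) j i -> avoid m j = 1.
Proof.
elim: m j => //= m IH j ncji; rewrite -[RHS](P_sum1 j) big_mkcond /=.
apply: eq_bigr => k _; have [Pjk|Pjk] := ltP 0 (P j k).
  have nck : ~~ connect (edge P) k i.
    by apply: contra ncji; apply: connect_trans; apply: connect1.
  by rewrite ifT ?IH ?mulr1 //; apply: contraNneq nck => ->.
have -> : P j k = 0 by apply/eqP; rewrite eq_le Pjk P_ge0.
by rewrite mul0r if_same.
Qed.

(** The constant is the product of the transition probabilities along a path to [j]. Shortening the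
    path to a simple one ensures that it does not revisit [i]; from its end on, [avoid] is 1. *)
Lemma avoid_bounded_below j :
  connect (edge P) i j -> ~~ connect (edge P) j i ->
  exists2 c : R, 0 < c & forall m, c <= avoid m i.
Proof.
move=> /connectP[p0 + ->]; case/shortenP=> p pp up _ ncji.
have {up} : i \notin p by case/andP: up.
(* The bound [c <= 1] handles the case where [m] steps do not exhaust the path. *)
suff: forall x, path (edge P) x p -> ~~ connect (edge P) (last x p) i ->
    i \notin p -> exists c, [/\ 0 < c, c <= 1 & forall m, c <= avoid m x].
  by move=> /(_ i pp ncji) H /H[c [c0 _ cm]]; exists c.
elim: p {pp ncji} => [|y p IH] x /=.
  by move=> _ nc _; exists 1; split=> // m; rewrite avoid_unreachable.
case/andP=> exy py nc; rewrite inE negb_or => /andP[iy ip].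
have [c [c0 c1 cm]] := IH y py nc ip.
have Pxy1 : P x y <= 1.
  by rewrite -(P_sum1 x) (bigD1 y) //= lerDl sumr_ge0.
exists (P x y * c); split; first exact: mulr_gt0.
  by rewrite mulr_ile1 // ltW.
case=> [|m] /=; first by rewrite mulr_ile1 // ltW.
rewrite (bigD1 y) 1?eq_sym //=; apply: le_trans (ler_wpM2l (P_ge0 _ _) (cm m)) _.
by rewrite lerDl sumr_ge0 // => k _; rewrite mulr_ge0 ?avoid_ge0.
Qed.

End Taboo.

(** * Return times *)

Section Chain.
Variables (R : realType) (S : finType) (P : S -> S -> R).
Variables (d : measure_display) (T : measurableType d) (Pr : probability T R).
Variables (X : nat -> T -> S) (i : S).
Hypotheses (hP : stochastic P) (hX : markov_chain P Pr X).

Definition cylinder (n : nat) (x : nat -> S) : set T :=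
  [set w | forall k, (k <= n)%N -> X k w = x k].

Definition no_visit (n m : nat) : set T :=
  [set w | forall k, (n < k <= n + m)%N -> X k w != i].

Lemma measurable_state n j : measurable [set w | X n w = j].
Proof. by case: hX. Qed.

Lemma measurable_cylinder n x : measurable (cylinder n x).
Proof.
rewrite (_ : cylinder n x = \bigcap_(k in `I_n.+1) [set w | X k w = x k]) //.
by apply: bigcap_measurableType => k _; apply: measurable_state.
Qed.

Lemma measurable_no_visit n m : measurable (no_visit n m).
Proof.
rewrite (_ : no_visit n m =
    \bigcap_(k in [set k | (n < k <= n + m)%N]) ~` [set w | X k w = i]).
  apply: bigcap_measurableType => k _; exact/measurableC/measurable_state.
by apply/seteqP; split=> w Hw k /Hw /eqP.
Qed.

Lemma no_visit0 n : no_visit n 0 = setT.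
Proof.
by apply/seteqP; split=> // w _ k; rewrite addn0 ltnNge; case: (k <= n)%N.
Qed.

(** The product form also covers null cylinders, on which the Markov property is silent: both sides
    then vanish. *)
Lemma markov_step n x j :
  Pr (cylinder n x `&` [set w | X n.+1 w = j]) =
  (Pr (cylinder n x) * (P (x n) j)%:E)%E.
Proof.
have mc := measurable_cylinder n x; have ms := measurable_state n.+1 j.
have [Pr0|Pr_neq0] := eqVneq (Pr (cylinder n x)) 0%E.
  rewrite Pr0 mul0e; apply/eqP; rewrite -measure_le0 -Pr0.
  exact: measureIl.
have Pr_gt0 : (0 < Pr (cylinder n x))%E by rewrite lt0e Pr_neq0 measure_ge0.
have [_ /(_ n x j Pr_gt0)] := hX.
rewrite /cond_prob -/(cylinder n x) setIC => <-.
by rewrite muleC -muleA mulVe ?mule1 // fin_num_measure.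
Qed.

(** Split by the state [j != i] at time [n.+1]: each piece is a cylinder one step longer, followed
    by a window one step shorter. *)
Lemma prob_no_visit m n x :
  Pr (cylinder n x `&` no_visit n m) =
  (Pr (cylinder n x) * (avoid P i m (x n))%:E)%E.
Proof.
elim: m n x => [|m IH] n x; first by rewrite no_visit0 setIT mule1.
pose y j k := if (k <= n)%N then x k else j.
have cylS j : cylinder n.+1 (y j) = cylinder n x `&` [set w | X n.+1 w = j].
  apply/seteqP; split=> [w Hw|w [Hw Hj] k].
    split=> [k kn|]; first by rewrite Hw ?leqW // /y kn.
    by rewrite /= Hw // /y ltnn.
  by rewrite leq_eqVlt ltnS /y => /predU1P[->|kn]; [rewrite ltnn | rewrite kn Hw].
have -> : cylinder n x `&` no_visit n m.+1 =
    \bigcup_(j in [set j | j != i]) (cylinder n.+1 (y j) `&` no_visit n.+1 m).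
  apply/seteqP; split=> [w [Hc Hn]|w [j /= ji [+ Hn]]].
    exists (X n.+1 w); first by apply: Hn; rewrite ltnSn addnS ltnS leq_addr.
    split; first by rewrite cylS.
    by move=> k /andP[nk kn]; apply: Hn; rewrite ltnW //= addnS -addSn.
  rewrite cylS => -[Hc Hj]; split=> // k /andP[].
  rewrite leq_eqVlt => /predU1P[<-|nk kn]; first by rewrite Hj.
  by apply: Hn; rewrite nk addSn -addnS.
rewrite measure_fin_bigcup //=; last 2 first.
- move=> j k _ _ [w]; rewrite !cylS => -[[[_ /= <-] _] [[_ /= <-] _]] //.
- by move=> j _; apply: measurableI;
    [apply: measurable_cylinder | apply: measurable_no_visit].
(* The sum over a set of states becomes the big sum in the definition of [avoid]. *)
rewrite -(bigfs _ (r := index_enum S)) ?index_enum_uniq //=; last first.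
  by move=> j _; rewrite mem_index_enum.
under eq_bigr => j ji.
  rewrite IH cylS markov_step /y ltnn -muleA -EFinM; over.
rewrite -ge0_sume_distrr ?sumEFin // => j ji.
by rewrite lee_fin mulr_ge0 ?avoid_ge0 //; case: hP.
Qed.

Let start : set T := [set w | X 0%N w = i].
Let mstart : measurable start := measurable_state 0 i.

Definition unreturned (m : nat) : set T := start `&` no_visit 0 m.

Lemma measurable_unreturned m : measurable (unreturned m).
Proof. exact: measurableI (measurable_no_visit 0 m). Qed.

Lemma prob_unreturned m :
  Pr (unreturned m) = (Pr start * (avoid P i m i)%:E)%E.
Proof.
have startE : start = cylinder 0 (fun=> i).
  by apply/seteqP; split=> w; [move=> H k; rewrite leqn0 => /eqP-> | apply].
by rewrite /unreturned startE prob_no_visit.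
Qed.

Lemma return_time_ltyP w :
  (return_time R X i w < +oo)%E <-> exists2 n, (1 <= n)%N & X n w = i.
Proof.
split=> [/ereal_inf_lt[_ [n [n1 Xn] <-] _]|[n n1 Xn]]; first by exists n.
by apply: le_lt_trans (ltry n%:R); apply: ereal_inf_lbound; exists n.
Qed.

Lemma never_returned :
  start `\` [set w | (return_time R X i w < +oo)%E] = \bigcap_m unreturned m.
Proof.
apply/seteqP; split=> w.
  move=> [sw nret] m _; split=> // k /andP[k0 _]; apply/eqP => Xk.
  by apply: nret; apply/return_time_ltyP; exists k.
move=> H; split; first by have [] := H 0%N I.
case/return_time_ltyP=> n n1 Xn; have [_ /(_ n)] := H n I.
by rewrite n1 leqnn Xn eqxx => /(_ isT).
Qed.

Lemma measurable_returned :
  measurable [set w | (return_time R X i w < +oo)%E].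
Proof.
rewrite (_ : mkset _ = \bigcup_(n in [set n | (1 <= n)%N]) [set w | X n w = i]).
  by apply: bigcup_measurable => n _; apply: measurable_state.
apply/seteqP; split=> w /=; first by case/return_time_ltyP=> n; exists n.
by case=> n n1 Xn; apply/return_time_ltyP; exists n.
Qed.

Hypothesis start_gt0 : (0 < Pr start)%E.

Let fin_start : Pr start \is a fin_num := fin_num_measure Pr _ mstart.

(** [Pr start] is finite and splits as [a + b], with [a] for never returning and [b] for returning;
    the quotient of [b] by it is 1 exactly when [a] is 0. *)
Lemma returns_asP :
  returns_as Pr X i <-> Pr (\bigcap_m unreturned m) = 0%E.
Proof.
have m1 := measurable_returned; have neq0 : Pr start != 0 by rewrite gt_eqF.
rewrite /returns_as /cond_prob -/start.
set a := Pr (\bigcap_m _); set b := Pr (_ `&` _).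
have e : Pr start = (a + b)%E.
  by rewrite /a -never_returned /b setIC; apply: measureDI.
have fa : a \is a fin_num.
  apply: fin_num_measure; rewrite -never_returned; exact: measurableD.
have fb : b \is a fin_num by apply: fin_num_measure; apply: measurableI.
split=> [ret|a0]; last by rewrite -[b]add0e -a0 -e divee.
have b1 : b = Pr start by rewrite -[b]mule1 -(mulVe neq0 fin_start) muleA ret mul1e.
by move/(congr1 (fun z => z - Pr start)%E): e; rewrite b1 subee // addeK.
Qed.

Lemma prob_never_returned_le m :
  (Pr (\bigcap_m unreturned m) <= Pr start * (avoid P i m i)%:E)%E.
Proof.
rewrite -prob_unreturned; apply: le_measure; rewrite ?inE.
- by apply: bigcap_measurableType => k _; exact: measurable_unreturned.
- exact: measurable_unreturned.
- by move=> w /(_ m I).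
Qed.

(** Continuity from above along the decreasing events [unreturned m]. *)
Lemma prob_never_returned_ge (c : R) : (forall m, c <= avoid P i m i) ->
  (Pr start * c%:E <= Pr (\bigcap_m unreturned m))%E.
Proof.
move=> hc.
have := @nonincreasing_cvg_mu _ _ _ Pr unreturned.
move=> /(_ _ measurable_unreturned) cv.
have {cv} : (Pr \o unreturned) m @[m --> \oo] --> Pr (\bigcap_m unreturned m).
  apply: cv.
  - by rewrite ltey_eq fin_num_measure //; exact: measurable_unreturned.
  - by apply: bigcap_measurableType => k _; exact: measurable_unreturned.
  - move=> m n mn; apply/subsetPset => w [sw H]; split=> // k /andP[k0 km].
    by apply: H; rewrite k0 (leq_trans km).
move=> cv; rewrite -(cvg_lim _ cv) //; apply: lime_ge.
  by apply/cvg_ex; eexists; exact: cv.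
near=> m; rewrite /= prob_unreturned lee_wpmul2l ?measure_ge0 // lee_fin.
exact: hc.
Unshelve. all: end_near. Qed.

Lemma nneseries1_pinfty (f : nat -> R) : (forall n, f n = 1) ->
  (\sum_(0 <= m <oo) (f m)%:E = +oo)%E.
Proof.
move=> f1; apply/eqyP => A A0.
apply: (@le_trans _ _ (\sum_(0 <= m < Num.bound A) (f m)%:E)%E).
  rewrite big_mkord sumEFin lee_fin; under eq_bigr do rewrite f1.
  by rewrite sumr_const card_ord; apply/ltW/archi_boundP/ltW.
by apply: nneseries_lim_ge => n _ _; rewrite f1 lee_fin.
Qed.

(** The tail-sum formula, pointwise: the [m]-th indicator is 1 exactly when the return time exceeds
    [m]. With no return at all, every term is 1. *)
Lemma return_time_series w :
  return_time R X i w = (\sum_(0 <= m <oo) (\1_(no_visit 0 m) w)%:E)%E.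
Proof.
have [[n0 [n01 Xn0]]|no] := pselect (exists n, (1 <= n)%N /\ X n w = i); last first.
  transitivity (+oo%E : \bar R).
    by apply/ereal_inf_pinfty => y [n [n1 Xn] _]; case: no; exists n.
  rewrite nneseries1_pinfty // => m.
  rewrite indicE mem_set // => k /andP[k0 _]; apply/eqP => Xk.
  by case: no; exists k.
have ex : exists n, (1 <= n)%N && (X n w == i).
  by exists n0; rewrite n01 Xn0 eqxx.
case: (ex_minnP ex) => n /andP[n1 /eqP Xn] min_n.
have -> : return_time R X i w = n%:R%:E.
  apply/le_anti/andP; split; first by apply: ereal_inf_lbound; exists n.
  apply: le_ereal_inf_tmp => _ [k [k1 Xk] <-]; rewrite lee_fin ler_nat.
  by apply: min_n; rewrite k1 Xk eqxx.
have ind m : \1_(no_visit 0 m) w = (m < n)%:R :> R.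
  rewrite indicE; congr (_%:R); congr nat_of_bool.
  apply/idP/idP => [/set_mem H|mn].
    rewrite ltnNge; apply/negP => nm.
    by have := H n; rewrite n1 add0n nm Xn eqxx => /(_ isT).
  apply/mem_set => k /andP[k0 km]; apply/negP => /eqP Xk.
  have := min_n k; rewrite Xk eqxx k0 => /(_ isT); rewrite leqNgt.
  by rewrite (leq_ltn_trans km).
under eq_eseriesr do rewrite ind.
rewrite (nneseries_split 0 n); last by move=> k _; rewrite lee_fin ler0n.
rewrite add0n [X in (_ + X)%E]eseries0 ?adde0; last first.
  by move=> k nk _; rewrite ltnNge nk.
rewrite big_mkord sumEFin (eq_bigr (fun=> 1)) ?sumr_const ?card_ord //.
by move=> k _; rewrite ltn_ord.
Qed.

(** Integrating the tail-sum formula term by term is allowed because all terms are nonnegative. *)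
Lemma mean_return_series :
  (\int[Pr]_(w in start) return_time R X i w =
   \sum_(0 <= m <oo) Pr (unreturned m))%E.
Proof.
under eq_integral do rewrite return_time_series.
rewrite integral_nneseries //; last first.
  move=> m; apply/measurable_EFinP.
  exact/measurable_funTS/measurable_indic/measurable_no_visit.
apply: eq_eseriesr => m _; rewrite integral_indic //; last exact: measurable_no_visit.
by rewrite setIC.
Qed.

Lemma mean_return_lty (K : R) : (forall M, \sum_(m < M) avoid P i m i <= K) ->
  mean_return_finite Pr X i.
Proof.
move=> hK; rewrite /mean_return_finite /cond_expectation -/start.
rewrite mean_return_series.
have -> : (\sum_(0 <= m <oo) Pr (unreturned m) =
           Pr start * \sum_(0 <= m <oo) (avoid P i m i)%:E)%E.
  rewrite -(fineK fin_start) -nneseriesZl; last by move=> m _; rewrite lee_fin avoid_ge0.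
  by apply: eq_eseriesr => m _; rewrite prob_unreturned fineK.
rewrite muleC muleA mulVe ?gt_eqF // mul1e.
apply: le_lt_trans (ltry K).
apply: lime_le.
  by apply: is_cvg_nneseries => m _ _; rewrite lee_fin avoid_ge0.
by apply: nearW => M; rewrite big_mkord sumEFin lee_fin.
Qed.

End Chain.

(** * A chain with a given transition matrix and initial state *)

Section Subdivision.
Variables (R : realType) (S : finType) (q : S -> R).
Hypothesis q_ge0 : forall j, 0 <= q j.

(** The cuts divide the interval from 0 to the total weight into consecutive half-open intervals,
    one of length [q j] for each state [j], in the order of [enum S]. *)
Let cut (n : nat) : R := \sum_(k <- take n (enum S)) q k.

Definition left_end (j : S) : R := cut (index j (enum S)).

Let cut_le m n : (m <= n)%N -> cut m <= cut n.
Proof.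
move=> mn; rewrite /cut -[take n _](cat_take_drop m) take_takel //.
by rewrite big_cat /= lerDl sumr_ge0.
Qed.

Let cut_size : cut (size (enum S)) = \sum_k q k.
Proof. by rewrite /cut take_size big_enum. Qed.

Let cutS (j : S) : cut (index j (enum S)).+1 = left_end j + q j.
Proof.
have js : (index j (enum S) < size (enum S))%N by rewrite index_mem mem_enum.
by rewrite /cut (take_nth j) // nth_index ?mem_enum // big_rcons.
Qed.

Lemma left_end_ge0 j : 0 <= left_end j.
Proof. exact: sumr_ge0. Qed.

Lemma left_endD_le j : left_end j + q j <= \sum_k q k.
Proof. by rewrite -cutS -cut_size cut_le // index_mem mem_enum. Qed.

Lemma left_end_exists (v : R) :
  0 <= v < \sum_k q k -> exists j, left_end j <= v < left_end j + q j.
Proof.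
case/andP=> v0; rewrite -cut_size => vq.
(* The first cut beyond [v] is the right end of the interval sought. *)
case: (ex_minnP (ex_intro (fun n => v < cut n) _ vq)) => -[|m].
  by rewrite /cut take0 big_nil ltNge v0.
move=> vm min_m; have ms : (m < size (enum S))%N by apply: min_m.
have j0 : S by case: (enum S) ms.
have im : index (nth j0 (enum S) m) (enum S) = m.
  by rewrite index_uniq // enum_uniq.
exists (nth j0 (enum S) m); rewrite -cutS /left_end im vm andbT leNgt.
by apply/negP => /min_m; rewrite ltnn.
Qed.

Lemma left_end_inj (v : R) (j k : S) :
  left_end j <= v < left_end j + q j -> left_end k <= v < left_end k + q k ->
  j = k.
Proof.
move=> /andP[j1 j2] /andP[k1 k2].
have lt j' k' : v < left_end j' + q j' -> left_end k' <= v ->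
    (index k' (enum S) <= index j' (enum S))%N.
  move=> v2 v1; rewrite leqNgt; apply/negP => /cut_le; rewrite cutS => le.
  by have := lt_le_trans v2 (le_trans le v1); rewrite ltxx.
apply: (index_inj j (s := enum S)); rewrite ?mem_enum //.
by apply/eqP; rewrite eqn_leq !lt.
Qed.

End Subdivision.

(** * The uniform distribution on [0, 1[ *)

Section UniformMeasure.
Variable R : realType.

Definition uniform01 := mrestr (@lebesgue_measure R) (measurable_itv `[0, 1[).

HB.instance Definition _ := Measure.on uniform01.

Let uniform01_setT : uniform01 [set: _] = 1%E.
Proof.
rewrite /uniform01 /mrestr setTI /= lebesgue_measure_itv /= lte_fin ltr01.
by rewrite oppr0 adde0.
Qed.

HB.instance Definition _ := Measure_isProbability.Build _ _ _ uniform01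
  uniform01_setT.

End UniformMeasure.
Arguments uniform01 R : clear implicits.

(* The chain is a function of one uniform variable [w] in [0, 1[: the histories
   (listed backwards) of a given length label a partition of [0, 1[ into
   intervals whose lengths are their probabilities, each refining the previous
   one, and the chain follows the labels of the intervals that contain [w]. *)
Section Construction.
Variables (R : realType) (S : finType) (P : S -> S -> R) (i : S).
Hypothesis hP : stochastic P.

(** Left end and length of the interval of a history, latest state first. A one-state history gets
    all of [0, 1[, since the initial state is fixed. *)
Fixpoint cell (s : seq S) : R * R :=
  if s is j :: s' then
    if s' is k :: _ then
      let q j := (cell s').2 * P k j in ((cell s').1 + left_end q j, q j)
    else (0, 1)
  else (0, 1).

Arguments cell : simpl never.

Definition in_cell (s : seq S) (w : R) : bool :=
  w \in `[(cell s).1, (cell s).1 + (cell s).2[.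

(** The default [i] is what makes the chain total: no cell contains a [w] outside [0, 1[. *)
Definition next (s : seq S) (w : R) : S :=
  odflt i [pick j | in_cell (j :: s) w].

Fixpoint history (n : nat) (w : R) : seq S :=
  if n is n'.+1 then next (history n' w) w :: history n' w else [:: i].

Definition chain (n : nat) (w : R) : S := head i (history n w).

Lemma cell_ge0 s : 0 <= (cell s).2.
Proof.
elim: s => [|j [|k s] IH]; rewrite ?ler01 //.
by apply: mulr_ge0 => //; case: hP.
Qed.

Definition child_weight (k : S) (s : seq S) (j : S) : R :=
  (cell (k :: s)).2 * P k j.

Lemma cellE j k s : cell [:: j, k & s] =
  ((cell (k :: s)).1 + left_end (child_weight k s) j, child_weight k s j).
Proof. by []. Qed.

Lemma child_weight_ge0 k s j : 0 <= child_weight k s j.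
Proof. by rewrite mulr_ge0 ?cell_ge0 //; case: hP. Qed.

Lemma child_weight_sum k s : \sum_j child_weight k s j = (cell (k :: s)).2.
Proof. by rewrite -mulr_sumr; case: hP => _ ->; rewrite mulr1. Qed.

Lemma in_cellE j k s w : in_cell [:: j, k & s] w =
  (left_end (child_weight k s) j <= w - (cell (k :: s)).1 <
   left_end (child_weight k s) j + child_weight k s j).
Proof.
by rewrite /in_cell cellE in_itv /= -addrA -lerBrDl -ltrBlDl.
Qed.

Lemma in_cell_sumE k s w : in_cell (k :: s) w =
  (0 <= w - (cell (k :: s)).1 < \sum_j child_weight k s j).
Proof. by rewrite child_weight_sum /in_cell in_itv /= subr_ge0 ltrBlDl. Qed.

Lemma in_cellW j k s w : in_cell [:: j, k & s] w -> in_cell (k :: s) w.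
Proof.
have w0 := child_weight_ge0 k s.
rewrite in_cellE in_cell_sumE => /andP[h1 h2].
rewrite (le_trans _ h1) ?left_end_ge0 //=.
by apply: lt_le_trans h2 _; apply: left_endD_le.
Qed.

Lemma in_cell_inj j j' k s w :
  in_cell [:: j, k & s] w -> in_cell [:: j', k & s] w -> j = j'.
Proof. rewrite !in_cellE; apply: left_end_inj; exact: child_weight_ge0. Qed.

Lemma in_cell_exists k s w :
  in_cell (k :: s) w -> exists j, in_cell [:: j, k & s] w.
Proof.
rewrite in_cell_sumE => /left_end_exists[j hj].
by exists j; rewrite in_cellE.
Qed.

Lemma next_in_cell j k s w :
  in_cell (k :: s) w -> next (k :: s) w = j <-> in_cell [:: j, k & s] w.
Proof.
move=> ks; rewrite /next; case: pickP => [l wl|no] /=.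
  by split=> [<- //|/(in_cell_inj wl)].
by have [l] := in_cell_exists ks; rewrite no.
Qed.

Lemma measurable_in_cell s : measurable [set w | in_cell s w].
Proof. exact: measurable_itv. Qed.

Lemma measurable_next k s j : measurable [set w | next (k :: s) w = j].
Proof.
pose some := \bigcup_(l in [set: S]) [set w | in_cell [:: l, k & s] w].
have msome : measurable some.
  apply: fin_bigcup_measurable => // l _; exact: measurable_in_cell.
(* The value [j] comes either from its own cell or, off all child cells, from the default when
   [i = j]. *)
rewrite (_ : [set w | _ = j] = [set w | in_cell [:: j, k & s] w] `|`
    (~` some `&` [set w | i = j])); last first.
  apply/seteqP; split=> w /=; rewrite /next; case: pickP => [l wl|no] /=.
  - by move=> <-; left.
  - by move=> ->; right; split=> // -[l _] /=; rewrite no.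
  - case=> [/(in_cell_inj wl) //|[nsome _]]; exfalso.
    by apply: nsome; exists l.
  - by rewrite no; case=> // -[].
apply: measurableU; first exact: measurable_in_cell.
apply: measurableI; first exact: measurableC.
have [ij|ij] := pselect (i = j).
  by rewrite (_ : mkset _ = setT) //; apply/seteqP; split.
by rewrite (_ : mkset _ = set0) //; apply/seteqP; split.
Qed.

Lemma history_cons n w : exists k s, history n w = k :: s.
Proof. by case: n => [|n] /=; do 2 eexists. Qed.

Lemma measurable_history n s : measurable [set w | history n w = s].
Proof.
elim: n s => [|n IH] s.
  have [<-|ne] := eqVneq [:: i] s.
    by rewrite (_ : mkset _ = setT) //; apply/seteqP; split.
  rewrite (_ : mkset _ = set0) //; apply/seteqP; split=> // w /= /eqP.
  by rewrite (negPf ne).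
case: s => [|j [|k s]].
- by rewrite (_ : mkset _ = set0) //; apply/seteqP; split.
- rewrite (_ : mkset _ = set0) //; apply/seteqP; split=> // w /= [_].
  by have [k [s ->]] := history_cons n w.
- rewrite (_ : mkset _ = [set w | history n w = k :: s] `&`
                         [set w | next (k :: s) w = j]).
    by apply: measurableI => //; apply: measurable_next.
  apply/seteqP; split=> w /=; first by case=> <- <-.
  by case=> -> ->.
Qed.

Lemma measurable_chain n j : measurable [set w | chain n w = j].
Proof.
rewrite (_ : mkset _ = \bigcup_s [set w | history n w = j :: s]).
  by apply: countable_bigcupT_measurable => // s; apply: measurable_history.
apply/seteqP; split=> w /=; last by case=> s _ /=; rewrite /chain => ->.
by have [k [s e]] := history_cons n w; rewrite /chain e => <-; exists s.
Qed.

Fixpoint backwards (x : nat -> S) (n : nat) : seq S :=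
  if n is n'.+1 then x n :: backwards x n' else [:: x 0%N].

Lemma backwards_cons x n : exists s, backwards x n = x n :: s.
Proof. by case: n => [|n] /=; eexists. Qed.

(** This turns each cylinder event of the chain into a single history, whose probability is the
    length of a cell. *)
Lemma chain_historyP x n w :
  (forall k, (k <= n)%N -> chain k w = x k) <->
  x 0%N = i /\ history n w = backwards x n.
Proof.
elim: n => [|n IH].
  split=> [H|[x0 _] k]; first by split; rewrite /= -(H 0%N).
  by rewrite leqn0 => /eqP ->; rewrite x0.
split=> [H|[x0 /= [xn hn]] k].
  have [|x0 hn] := (IH.1); first by move=> k kn; apply: H; rewrite leqW.
  by split=> //=; rewrite -hn -(H n.+1).
rewrite leq_eqVlt => /predU1P[->|]; first by [].
by apply: (IH.2 _).
Qed.

Lemma history_in_cell x n w : x 0%N = i -> w \in `[0, 1[ ->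
  history n w = backwards x n <-> in_cell (backwards x n) w.
Proof.
move=> x0 w01; elim: n => [|n IH].
  by rewrite /= x0 /in_cell /= add0r.
have [s es] := backwards_cons x n.
split=> [/= [hn hs]|].
  have := hs; move/IH; rewrite es => h.
  by apply/(next_in_cell (x n.+1) h); rewrite -es -hs.
rewrite /= es => h; have h' := in_cellW h.
have -> : history n w = backwards x n by apply/IH; rewrite es.
by rewrite es; congr (_ :: _); apply/(next_in_cell _ h').
Qed.

Lemma uniform01_history x n : x 0%N = i ->
  uniform01 R [set w | history n w = backwards x n] =
  (cell (backwards x n)).2%:E.
Proof.
move=> x0; rewrite /uniform01 /mrestr.
rewrite (_ : _ `&` _ = [set` `[(cell (backwards x n)).1,
    (cell (backwards x n)).1 + (cell (backwards x n)).2[]).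
  rewrite lebesgue_measure_itv /= lte_fin ltrDl.
  (* The measure formula distinguishes empty intervals, which occur here for histories of
     probability 0. *)
  have := cell_ge0 (backwards x n); rewrite le_eqVlt => /predU1P[<-|l0].
    by rewrite ltxx.
  by rewrite l0 -EFinB addrAC subrr add0r.
apply/seteqP; split=> w /=; first by case=> h w01; apply/history_in_cell.
move=> h; suff w01 : w \in `[0, 1[ by split=> //; apply/history_in_cell.
move: h; rewrite -/(in_cell _ w); elim: n => [|n IH].
  by rewrite /in_cell /= add0r.
have [s es] := backwards_cons x n; rewrite /= es => /in_cellW.
by rewrite -es.
Qed.

Lemma markov_chain_chain : markov_chain P (uniform01 R) chain.
Proof.
split=> [n j|n x j past Pr_gt0]; first exact: measurable_chain.
(* The chain starts at [i], so a past with another initial state is empty, against [Pr_gt0]. *)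
have [x0|x0] := eqVneq (x 0%N) i; last first.
  move: Pr_gt0; rewrite (_ : past = set0) ?measure0 ?ltxx //.
  by apply/seteqP; split=> // w /(_ 0%N isT) /= e; rewrite -e eqxx in x0.
have pastE : past = [set w | history n w = backwards x n].
  apply/seteqP; split=> w; first by case/chain_historyP.
  by move=> h; apply/chain_historyP.
(* Prolonging [x] by [j] makes the joint event a single history too; the conditional probability is
   then the ratio of a child cell to its parent. *)
pose y k := if (k <= n)%N then x k else j.
have yn : backwards y n = backwards x n.
  have : forall k, (k <= n)%N -> y k = x k by move=> k kn; rewrite /y kn.
  elim: (n) => [|m IH] H /=; first by rewrite H.
  by rewrite H // IH // => k km; apply: H; rewrite leqW.
have nextE : [set w | chain n.+1 w = j] `&` past =
    [set w | history n.+1 w = backwards y n.+1].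
  rewrite pastE; apply/seteqP; split=> w /=.
    by rewrite yn /y ltnn => -[<- <-].
  by rewrite yn /y ltnn => -[<- <-].
have y0 : y 0%N = i by [].
rewrite /cond_prob nextE pastE.
rewrite [X in (X / _)%E](uniform01_history n.+1 y0).
rewrite [X in (_ / X)%E](uniform01_history n x0).
move: Pr_gt0; rewrite pastE [ltRHS](uniform01_history n x0) lte_fin => l0.
have [s es] := backwards_cons x n.
rewrite /= yn es; rewrite cellE /child_weight /= -es /y ltnn inver gt_eqF //.
rewrite -EFinM; congr EFin.
by rewrite mulrC mulrA mulVf ?mul1r // gt_eqF.
Qed.

Lemma chain_start : uniform01 R [set w | chain 0 w = i] = 1%E.
Proof.
rewrite (_ : mkset _ = setT) ?probability_setT //.
by apply/seteqP; split.
Qed.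

End Construction.

(** * Recurrence *)

Section Recurrence.
Variables (R : realType) (S : finType) (P : S -> S -> R) (i : S).
Variables (d : measure_display) (T : measurableType d) (Pr : probability T R).
Variable X : nat -> T -> S.
Hypotheses (hP : stochastic P) (hX : markov_chain P Pr X).
Hypothesis start_gt0 : (0 < Pr [set w | X 0%N w = i])%E.

Let closed_i := forall j, connect (edge P) i j -> connect (edge P) j i.

Let fine_gt0 : 0 < fine (Pr [set w | X 0%N w = i]).
Proof.
by rewrite fine_gt0 // start_gt0 ltey_eq fin_num_measure //; case: hX.
Qed.

Let start_fineE :
  Pr [set w | X 0%N w = i] = (fine (Pr [set w | X 0%N w = i]))%:E.
Proof. by rewrite fineK // fin_num_measure //; case: hX. Qed.

(** The probability of never returning is at most [Pr start * avoid m] for every [m], hence below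
    any [e > 0]; the tolerance for [avoid] is [e] divided by the initial mass at [i]. *)
Lemma closed_returns_as : closed_i -> returns_as Pr X i.
Proof.
move=> cl; apply/(returns_asP hX start_gt0)/eqP; rewrite -measure_le0.
apply/lee_addgt0Pr => e e0; rewrite add0e.
have [m hm] := avoid_small hP cl (divr_gt0 e0 fine_gt0).
apply: le_trans (prob_never_returned_le i hP hX m) _.
rewrite start_fineE -EFinM lee_fin mulrC -ler_pdivlMr //; exact: ltW.
Qed.

Lemma closed_mean_return_finite : closed_i -> mean_return_finite Pr X i.
Proof.
by move=> /(avoid_summable hP)[K hK]; apply: (mean_return_lty hP hX start_gt0 hK).
Qed.

Lemma returns_as_closed : returns_as Pr X i -> closed_i.
Proof.
move=> /(returns_asP hX start_gt0) never j cij; apply: contraT => ncji.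
have [c c0 hc] := avoid_bounded_below hP cij ncji.
have := prob_never_returned_ge hP hX hc.
by rewrite never start_fineE -EFinM lee_fin leNgt mulr_gt0.
Qed.

End Recurrence.

Theorem fact12 (R : realType) (S : finType) (P : S -> S -> R)
    (d : measure_display) (T : measurableType d) (Pr : probability T R)
    (X : nat -> T -> S)
    (hP : stochastic P) (hX : markov_chain P Pr X) (i : S) :
  (recurrent P Pr X i <-> positive_recurrent P Pr X i) /\
  (positive_recurrent P Pr X i <->
   (\bigcup_(C in [set C | maximal_class (edge P) C]) C) i).
Proof.
pose closed_i := forall j, connect (edge P) i j -> connect (edge P) j i.
have rec_closed : recurrent P Pr X i -> closed_i.
  case=> charged uncharged.
  have [Pr0|Pr_neq0] := eqVneq (Pr [set w | X 0%N w = i]) 0%E.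
    (* Recurrence now speaks only of restarted chains, so it is applied to the constructed one. *)
    have Y_start : (0 < uniform01 R [set w | chain P i 0 w = i])%E.
      by rewrite chain_start.
    have hY := markov_chain_chain i hP.
    exact: returns_as_closed hP hY Y_start (uncharged Pr0 _ _ _ _ hY Y_start).
  have X_start : (0 < Pr [set w | X 0%N w = i])%E.
    by rewrite lt0e Pr_neq0 measure_ge0.
  exact: returns_as_closed hP hX X_start (charged X_start).
have closed_pos : closed_i -> positive_recurrent P Pr X i.
  move=> cl; split; split=> [X_start|_ d' T' Pr' X' hX' X_start].
  - exact: closed_returns_as hP hX X_start cl.
  - exact: closed_returns_as hP hX' X_start cl.
  - exact: closed_mean_return_finite hP hX X_start cl.
  - exact: closed_mean_return_finite hP hX' X_start cl.
have maximalP := maximal_classP i (stochastic_out hP).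
split; split.
- by move=> /rec_closed /closed_pos.
- by case.
- by case=> /rec_closed /maximalP.
- by move=> /maximalP /closed_pos.
Qed.
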